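(* Let $G=(V,E)$ be a connected finite simple graph of order $n$ with minimum degree $\delta(G)\ge 2$. Then $Z(D_t(G,x))=\{-3,0\}$ if and only if $G$ is (isomorphic to) the cycle $C_3$ or the cycle $C_6$.
   Context: For a finite simple graph $G=(V,E)$, a set $D\subseteq V$ is a total dominating set if every vertex of $V$ is adjacent to some vertex of $D$. $d_t(G,i)$ is the number of total dominating sets of $G$ of cardinality $i$, and $D_t(G,x)=\sum_i d_t(G,i)x^i$ is the total domination polynomial. $Z(D_t(G,x))$ denotes the set of distinct (complex) roots of $D_t(G,x)$. $C_n$ is the cycle of order $n$. *)

(* Defs.v *)
From mathcomp Require Import all_boot all_order all_algebra.
From mathcomp Require Import classical_sets reals.
From mathcomp Require Import complex.

Set Implicit Arguments.
Unset Strict Implicit.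
Unset Printing Implicit Defensive.

Import GRing.Theory.

Local Open Scope ring_scope.

Record sgraph := SGraph {
  vertex :> finType;
  adj : rel vertex;
  adj_sym : symmetric adj;
  adj_irr : irreflexive adj }.

Definition connected_graph (G : sgraph) : Prop :=
  (0 < #|G|)%N /\ forall u v : G, connect (@adj G) u v.

Definition degree (G : sgraph) (v : G) : nat := #|[set u : G | adj v u]|.

(* The default #|G| exceeds every degree, so it only matters for the empty
   graph, whose minimum degree is then 0. *)
Definition min_degree (G : sgraph) : nat :=
  \big[minn/#|G|]_(v : G) degree v.

Definition graph_iso (G H : sgraph) : Prop :=
  exists2 f : G -> H, bijective f & forall u v : G, adj (f u) (f v) = adj u v.

(* [ordS] is the successor modulo n; the condition i != j only matters for
   n = 1, where it removes the loop. *)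
Definition cycle_adj (n : nat) : rel 'I_n :=
  fun i j => (i != j) && ((j == ordS i) || (i == ordS j)).

Lemma cycle_adj_sym (n : nat) : symmetric (@cycle_adj n).
Proof. by move=> i j; rewrite /cycle_adj eq_sym orbC. Qed.

Lemma cycle_adj_irr (n : nat) : irreflexive (@cycle_adj n).
Proof. by move=> i; rewrite /cycle_adj eqxx. Qed.

Definition cycle_graph (n : nat) : sgraph :=
  SGraph (@cycle_adj_sym n) (@cycle_adj_irr n).

Definition total_dominating (G : sgraph) (D : {set G}) : bool :=
  [forall v : G, exists u in D, adj v u].

Definition dt (G : sgraph) (i : nat) : nat :=
  #|[set D : {set G} | total_dominating D & #|D| == i]|.

Definition total_domination_poly (A : nzRingType) (G : sgraph) : {poly A} :=
  \sum_(i < #|G|.+1) (dt G i)%:R *: 'X^i.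

Definition root_set (A : nzRingType) (p : {poly A}) : set A :=
  [set z | root p z]%classic.

(* Main.v *)
(** If the roots are -3 and 0, then D_t(G,x) = x^k (x+3)^l with k + l = n. A set
    is total dominating iff its complement contains no open neighbourhood. Since
    all degrees are at least 2, the coefficient of x^(n-1) is n, so n = 3l, and
    the coefficient of x^(n-2) is C(n,2) minus the number of distinct open
    neighbourhoods of size 2. Comparing with 9 C(l,2), this number is n, so G is
    2-regular with pairwise distinct neighbourhoods. As D_t has no term below
    x^(2l), sets containing no open neighbourhood have at most n/3 elements.
    These are the independent sets of the graph joining x and y when
    {x, y} = N(v) for some v, which has maximum degree 2; greedy extension shows
    that it is a disjoint union of triangles, which forces G to close up as
    C_3 or C_6. *)

Require Import Defs.
From mathcomp Require Import all_boot all_order all_algebra.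
From mathcomp Require Import classical_sets reals.
From mathcomp Require Import complex.
From mathcomp Require Import zify ring.

Import GRing.Theory.

Local Open Scope ring_scope.

(** * Open neighbourhoods and the top coefficients of the polynomial *)

Definition nbhd {G : sgraph} (v : G) : {set G} := [set u | adj v u].

Definition nbhd_free {G : sgraph} (S : {set G}) : bool :=
  [forall v : G, ~~ (nbhd v \subset S)].

Lemma nbhd_sym {G : sgraph} (u v : G) : (u \in nbhd v) = (v \in nbhd u).
Proof. by rewrite !inE adj_sym. Qed.

Lemma min_degree_le (G : sgraph) (v : G) : (min_degree G <= #|nbhd v|)%N.
Proof.
rewrite /min_degree; have := mem_index_enum v.
elim: (index_enum _) => // x s IHs; rewrite inE big_cons geq_min.
by case/orP=> [/eqP<-|/IHs->]; rewrite ?leqnn ?orbT.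
Qed.

Lemma total_dominatingC (G : sgraph) (S : {set G}) :
  total_dominating (~: S) = nbhd_free S.
Proof.
apply: eq_forallb => v; apply/existsP/subsetPn.
  by case=> u /andP[]; rewrite finset.in_setC => uS vu; exists u; rewrite ?inE.
by case=> u; rewrite inE => vu uS; exists u; rewrite finset.in_setC uS.
Qed.

Lemma dt_compl (G : sgraph) (k : nat) : (k <= #|G|)%N ->
  dt G (#|G| - k) = #|[set S : {set G} | nbhd_free S & #|S| == k]|.
Proof.
move=> kG; rewrite -(card_imset _ (@finset.setC_inj G)); congr #|pred_of_set _|.
apply/setP=> D; rewrite inE.
apply/andP/imsetP => [[tdD /eqP cD]|[S]].
  exists (~: D); last by rewrite finset.setCK.
  rewrite inE -total_dominatingC finset.setCK tdD /=.
  by have := finset.cardsC D; lia.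
rewrite inE -total_dominatingC => /andP[? /eqP cS] ->; split=> //.
by have := finset.cardsC S; lia.
Qed.

Lemma dt_order (G : sgraph) : (forall v : G, 1 < #|nbhd v|)%N -> dt G #|G| = 1%N.
Proof.
move=> deg; rewrite -[#|G| in LHS]subn0 dt_compl //.
rewrite -(cards1 (finset.set0 : {set G})); congr #|pred_of_set _|.
apply/setP=> S; rewrite !inE cards_eq0 andbC.
case: eqP => //= ->; apply/forallP=> v; rewrite finset.subset0 -cards_eq0.
by have := deg v; lia.
Qed.

Lemma dt_pred_order (G : sgraph) : (0 < #|G|)%N ->
  (forall v : G, 1 < #|nbhd v|)%N -> dt G (#|G| - 1) = #|G|.
Proof.
move=> G0 deg; rewrite dt_compl // -[RHS]bin1 -card_draws.
congr #|pred_of_set _|; apply/setP=> S; rewrite !inE andbC.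
case: eqP => //= cS; apply/forallP=> v; apply/negP => /subset_leq_card.
by have := deg v; lia.
Qed.

(** Since every neighbourhood has at least two elements, a pair that contains one is equal to it.
    The pairs that fail to be [nbhd_free] are thus the distinct neighbourhoods of size 2. *)
Lemma dt_order_sub2 (G : sgraph) : (1 < #|G|)%N ->
  (forall v : G, 1 < #|nbhd v|)%N ->
  (dt G (#|G| - 2) + #|[set nbhd v | v in [set v : G | #|nbhd v| == 2]]|
   = 'C(#|G|, 2))%N.
Proof.
move=> G1 deg; rewrite dt_compl // -card_draws.
rewrite -[RHS](cardsID [set S | nbhd_free S]); congr (_ + _)%N.
  by congr #|pred_of_set _|; apply/setP=> S; rewrite !inE andbC.
congr #|pred_of_set _|; apply/setP=> S; rewrite !inE; apply/imsetP/andP.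
  case=> v; rewrite inE => cv ->; split=> //.
  by apply/forallPn; exists v; rewrite negbK.
case=> /forallPn[v]; rewrite negbK => vS cS.
have eqS : nbhd v = S by apply/eqP; rewrite eqEcard vS (eqP cS) deg.
by exists v; rewrite // inE eqS.
Qed.

Lemma dt_eq0 (G : sgraph) (k : nat) : (k <= #|G|)%N ->
  (forall S : {set G}, nbhd_free S -> #|S| < k)%N -> dt G (#|G| - k) = 0%N.
Proof.
move=> kG small; rewrite dt_compl //; apply: eq_card0 => S; rewrite inE.
by apply/negP => /andP[/small]; lia.
Qed.

Lemma coef_total_domination_poly (A : nzRingType) (G : sgraph) (i : nat) :
  (i <= #|G|)%N -> (total_domination_poly A G)`_i = (dt G i)%:R.
Proof.
by move=> iG; rewrite /total_domination_poly -(poly_def _ (fun i => (dt G i)%:R))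
  coef_poly ltnS iG.
Qed.

Lemma size_total_domination_poly (A : nzRingType) (G : sgraph) :
  dt G #|G| = 1%N -> size (total_domination_poly A G) = #|G|.+1.
Proof.
move=> d1; rewrite /total_domination_poly -(poly_def _ (fun i => (dt G i)%:R)).
by rewrite size_poly_eq // d1 oner_eq0.
Qed.

(** * Monic polynomials with at most two roots *)

Lemma monic_two_roots (F : closedFieldType) (p : {poly F}) (a c : F) :
  p \is monic -> (forall z, root p z -> z = a \/ z = c) ->
  exists k l, p = ('X - a%:P) ^+ k * ('X - c%:P) ^+ l.
Proof.
have [r ->] := closed_field_poly_normal p => /monicP lc roots.
have {lc} lc1 : lead_coef p = 1.
  by move: lc; rewrite lead_coefZ (monicP (monic_prod_XsubC _ _ _)) mulr1.
have {roots} : forall z, z \in r -> z = a \/ z = c.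
  by move=> z zr; apply: roots; rewrite lc1 scale1r root_prod_XsubC.
rewrite lc1 scale1r => {p lc1}; elim: r => [_|z r IHr Hr].
  by exists 0%N, 0%N; rewrite big_nil mulr1.
have [|k [l IH]] := IHr; first by move=> y yr; apply: Hr; rewrite inE yr orbT.
rewrite big_cons IH; have [->|->] := Hr z (mem_head _ _).
  by exists k.+1, l; rewrite exprS mulrA.
by exists k, l.+1; rewrite exprS mulrCA.
Qed.

Lemma coef_Xn_XaddC_exp (A : comNzRingType) (c : A) (k l j : nat) :
  (j <= k + l)%N ->
  ('X^k * ('X + c%:P) ^+ l)`_(k + l - j) = c ^+ j *+ 'C(l, j).
Proof.
(* An index [k + l - j] below [k] means [l < j], where both sides vanish; otherwise only the
   binomial term [j] contributes. *)
move=> jkl; rewrite coefXnM; case: ltnP => [lt|ge].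
  by rewrite bin_small; last lia.
have jl : (j < l.+1)%N by lia.
rewrite exprDn coef_sum (bigD1 (Ordinal jl)) //= big1 => [|i ij].
  rewrite addr0 coefMn -polyC_exp coefMC coefXn.
  by rewrite (_ : (_ == _) = true) ?mul1r //; apply/eqP; lia.
rewrite coefMn -polyC_exp coefMC coefXn (_ : (_ == _) = false) ?mul0r ?mul0rn //.
apply/negbTE; apply: contra ij => /eqP eij; apply/eqP/val_inj => /=.
by have := ltn_ord i; lia.
Qed.

(** * The distance-2 graph of a 2-regular graph *)

(** The neighbours of [y] in the auxiliary graph whose edges are the open neighbourhoods of size 2.
    If [G] is 2-regular, its independent sets are the [nbhd_free] sets. *)
Definition dist2 {G : sgraph} (y : G) : {set G} :=
  [set x | (x != y) && [exists v, nbhd v == [set x; y]]].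

Lemma dist2P (G : sgraph) (x y : G) :
  reflect (x != y /\ exists v, nbhd v = [set x; y]) (x \in dist2 y).
Proof.
rewrite inE; apply: (iffP andP) => [[xy /existsP[v /eqP vE]]|[xy [v vE]]].
  by split; [|exists v].
by split=> //; apply/existsP; exists v; rewrite vE.
Qed.

Lemma nbhd_other (G : sgraph) (v u : G) : #|nbhd v| = 2%N -> u \in nbhd v ->
  exists2 w, w != u & nbhd v = [set u; w].
Proof.
move=> /eqP/cards2P[x [y [xy ->]]]; rewrite !inE => /orP[]/eqP->.
  by exists y; rewrite // eq_sym.
by exists x; rewrite // finset.setUC.
Qed.

Lemma set2_inj (T : finType) (x y z : T) : z != x -> [set x; z] = [set x; y] -> z = y.
Proof.
move=> zx /setP/(_ z); rewrite !inE eqxx orbT (negbTE zx) /=.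
by move/esym/eqP.
Qed.

Section TwoRegular.

Variable G : sgraph.
Hypothesis reg2 : forall v : G, #|nbhd v| = 2%N.

(** A vertex witnessing [x \in dist2 y] is one of the two neighbours of [y], and each of these has
    only one neighbour other than [y]. *)
Lemma card_dist2 (y : G) : (#|dist2 y| <= 2)%N.
Proof.
have /eqP/cards2P[p [q [_ yE]]] := reg2 y.
have [|p' p'y pE] := @nbhd_other G p y (reg2 p).
  by rewrite nbhd_sym yE !inE eqxx.
have [|q' q'y qE] := @nbhd_other G q y (reg2 q).
  by rewrite nbhd_sym yE !inE eqxx orbT.
apply: (@leq_trans #|[set p'; q']|); last by rewrite cards2; case: eqP.
apply/subset_leq_card/fintype.subsetP => x /dist2P[xy [v vE]].
have : v \in nbhd y by rewrite nbhd_sym vE !inE eqxx orbT.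
rewrite finset.setUC in vE.
rewrite yE !inE => /orP[]/eqP ev; move: vE; rewrite ev ?pE ?qE => /esym.
  by move/(set2_inj _ _ _ _ xy)->; rewrite eqxx.
by move/(set2_inj _ _ _ _ xy)->; rewrite eqxx orbT.
Qed.

Lemma card_dist2_closed (y : G) : (#|y |: dist2 y| <= 3)%N.
Proof. by rewrite cardsU1; have := card_dist2 y; case: (_ \notin _); lia. Qed.

Lemma card_dist2_cover (T : {set G}) :
  (#|\bigcup_(y in T) (y |: dist2 y)| <= 3 * #|T|)%N.
Proof.
rewrite mulnC -sum_nat_const.
elim/big_rec2: _ => [|y m U _ IH]; first by rewrite cards0.
by apply: leq_trans (leq_card_setU _ _) _; have := card_dist2_closed y; lia.
Qed.

(** If [x] lies outside [S], maximality makes [x |: S] contain some [nbhd v]. As [S] contains none,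
    [x] is one element of that pair, and the other lies in [S]. *)
Lemma maxset_nbhd_free_cover (S : {set G}) (x : G) :
  maxset nbhd_free S -> exists2 y, y \in S & x \in y |: dist2 y.
Proof.
case/maxsetP=> freeS maxS; have [xS|xS] := boolP (x \in S).
  by exists x => //; rewrite !inE eqxx.
have /forallPn[v] : ~~ nbhd_free (x |: S).
  apply: contra xS => freeU.
  by rewrite -(maxS _ freeU) ?finset.subsetUr // !inE eqxx.
rewrite negbK => vS.
have xv : x \in nbhd v.
  have /forallP/(_ v)/subsetPn[z zv zS] := freeS.
  have := fintype.subsetP vS z zv; rewrite in_setU1 (negbTE zS) orbF => /eqP <-.
  exact: zv.
have [y yx vE] := nbhd_other _ _ _ (reg2 v) xv.
exists y.
  have : y \in nbhd v by rewrite vE !inE eqxx orbT.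
  by move/(fintype.subsetP vS); rewrite in_setU1 (negbTE yx).
by rewrite in_setU1; apply/orP; right; apply/dist2P; rewrite eq_sym; split=> //; exists v.
Qed.

(* If a and c were not at distance 2, a maximal nbhd-free set containing both
   would exceed #|G| / 3: the closed distance-2 neighbourhoods of its elements
   have at most 3 elements and cover G, and those of a and c overlap in v. *)
Lemma dist2_triangle (small : forall S : {set G}, nbhd_free S -> (3 * #|S| <= #|G|)%N)
    (v a c : G) :
  v \in dist2 a -> v \in dist2 c -> a != c -> a \in dist2 c.
Proof.
move=> va vc ac; apply/idPn => nac.
have free2 : nbhd_free [set a; c].
  apply/forallP=> x; apply: contra nac => sub; apply/dist2P; split=> //.
  by exists x; apply/eqP; rewrite eqEcard sub reg2 cards2 ac.
have [S maxS subS] := maxset_exists free2.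
have := small S (maxsetp maxS).
have aS : a \in S by apply: (fintype.subsetP subS); rewrite !inE eqxx.
have cS : c \in S :\ a.
  by rewrite finset.in_setD1 eq_sym ac; apply: (fintype.subsetP subS); rewrite !inE eqxx orbT.
rewrite leqNgt => /negP; apply.
have cover : [set: G] \subset \bigcup_(y in S) (y |: dist2 y).
  apply/fintype.subsetP=> x _; have [y yS xy] := maxset_nbhd_free_cover _ x maxS.
  by apply/finset.bigcupP; exists y.
(* Splitting off [a] and [c] gives [#|G| <= (3 + 3 - 1) + 3 * (#|S| - 2) < 3 * #|S|]. *)
have := subset_leq_card cover; rewrite cardsT (big_setD1 a) //= (big_setD1 c) //=.
rewrite finset.setUA.
have [+ _] := leq_card_setU ((a |: dist2 a) :|: (c |: dist2 c))
  (\bigcup_(i in S :\ a :\ c) (i |: dist2 i)).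
have := cardsUI (a |: dist2 a) (c |: dist2 c).
have : (0 < #|(a |: dist2 a) :&: (c |: dist2 c)|)%N.
  by apply/card_gt0P; exists v; rewrite finset.in_setI !finset.in_setU1 va vc !orbT.
have := card_dist2_cover (S :\ a :\ c).
have := card_dist2_closed a; have := card_dist2_closed c.
have := cardsD1 c (S :\ a); have := cardsD1 a S; rewrite cS aS.
lia.
Qed.

End TwoRegular.

(** * Recognising the cycles of order 3 and 6 *)

Lemma connected_closed (G : sgraph) (A : {set G}) (x y : G) : connected_graph G ->
  x \in A -> (forall z, z \in A -> nbhd z \subset A) -> y \in A.
Proof.
case=> _ /(_ x y)/connectP[s]; elim: s x => [|z s IH] x /= => [_ -> //|].
case/andP=> xz pzs yE xA closedA; apply: (IH z) => //.
by apply: (fintype.subsetP (closedA x xA)); rewrite inE.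
Qed.

(** The image of [g] is closed under taking neighbours, so connectedness makes [g] surjective. *)
Lemma graph_iso_cycle (G : sgraph) (m : nat) (g : 'I_m.+1 -> G) :
  connected_graph G -> injective g ->
  (forall i, nbhd (g i) = [set g (ordS i); g (ord_pred i)]) ->
  graph_iso G (cycle_graph m.+1).
Proof.
move=> conn injg nbg.
have surj y : y \in codom g.
  have : y \in [set x in codom g].
    apply: (@connected_closed G _ (g ord0)) => //; first by rewrite inE codom_f.
    move=> z; rewrite inE => /codomP[i ->]; rewrite nbg.
    by apply/fintype.subsetP => w; rewrite !inE => /orP[]/eqP->; apply: codom_f.
  by rewrite inE.
pose f y : 'I_m.+1 := iinv (surj y).
have fK : cancel f g by move=> y; rewrite /f f_iinv.
have gK : cancel g f by move=> i; apply: injg; rewrite fK.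
exists f => [|u v]; first by exists g.
rewrite -{2}(fK u) -{2}(fK v); move: (f u) (f v) => i j.
have -> : adj (g i) (g j) = (g j \in nbhd (g i)) by rewrite inE.
rewrite /= /cycle_adj nbg !inE !(inj_eq injg).
have -> : (i == ordS j) = (j == ord_pred i).
  by rewrite eq_sym (can2_eq (@ordSK _) (@ord_predK _)).
(* On the diagonal [cycle_adj] is false by definition; the other side is false because [G] has no
   loops. *)
have [eij|//] := eqVneq i j.
have : g i \notin nbhd (g i) by rewrite inE adj_irr.
by rewrite nbg !inE !(inj_eq injg) -eij => /negbTE.
Qed.

(** Two paths leave a vertex [v]: [v, u, a] and [v, w, c]. If [a = w], they close up as a triangle.
    Otherwise [a] and [c] are both at distance 2 from [v], so [dist2_triangle] gives them a common
    neighbour [d], which closes a hexagon. *)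
Lemma two_regular_cycle3_or_6 (G : sgraph) : connected_graph G ->
  (forall v : G, #|nbhd v| = 2%N) -> injective (@nbhd G) ->
  (forall S : {set G}, nbhd_free S -> (3 * #|S| <= #|G|)%N) ->
  graph_iso G (cycle_graph 3) \/ graph_iso G (cycle_graph 6).
Proof.
move=> conn reg2 injN small.
have [/card_gt0P[v _] _] := conn.
have /eqP/cards2P[u [w [uw vE]]] := reg2 v.
have vu : v \in nbhd u by rewrite nbhd_sym vE !inE eqxx.
have vw : v \in nbhd w by rewrite nbhd_sym vE !inE eqxx orbT.
have [a av uE] := nbhd_other _ _ _ (reg2 u) vu.
have [c cv wE] := nbhd_other _ _ _ (reg2 w) vw.
have neq (x y : G) : y \in nbhd x -> x != y.
  by apply: contraTneq => ->; rewrite inE adj_irr.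
have nvu : v != u by apply: neq; rewrite vE !inE eqxx.
have nvw : v != w by apply: neq; rewrite vE !inE eqxx orbT.
have nua : u != a by apply: neq; rewrite uE !inE eqxx orbT.
have nwc : w != c by apply: neq; rewrite wE !inE eqxx orbT.
(* This excludes the 4-cycle, in which [u] and [w] would share their neighbourhood. *)
have ac : a != c.
  by apply: contraNneq uw => ac; apply/eqP/injN; rewrite uE wE ac.
have [aw|naw] := eqVneq a w.
  left; have cu : c = u.
    have : u \in nbhd w by rewrite nbhd_sym uE aw !inE eqxx orbT.
    by rewrite wE !inE eq_sym (negbTE nvu) => /eqP.
  subst a c; apply: (@graph_iso_cycle G 2 (fun i : 'I_3 => nth v [:: v; u; w] i)) => //.
    move=> i j /eqP; rewrite nth_uniq //=; first by move/eqP/val_inj.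
    by rewrite !inE negb_or nvu nvw uw.
  by case=> [[|[|[|//]]] ?]; rewrite /= ?vE ?uE ?wE // finset.setUC.
have [cu|ncu] := eqVneq c u.
  have : w \in nbhd u by rewrite nbhd_sym wE cu !inE eqxx orbT.
  by rewrite uE !inE eq_sym (negbTE nvw) eq_sym (negbTE naw).
right.
have va : v \in dist2 a by apply/dist2P; rewrite eq_sym; split=> //; exists u.
have vc : v \in dist2 c by apply/dist2P; rewrite eq_sym; split=> //; exists w.
have /dist2P[_ [d dE]] := dist2_triangle G reg2 small v a c va vc ac.
have da : d \in nbhd a by rewrite nbhd_sym dE !inE eqxx.
have dc : d \in nbhd c by rewrite nbhd_sym dE !inE eqxx orbT.
have ua : u \in nbhd a by rewrite nbhd_sym uE !inE eqxx orbT.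
have wc : w \in nbhd c by rewrite nbhd_sym wE !inE eqxx orbT.
have nad := neq a d da; have ncd := neq c d dc.
have nvd : v != d.
  apply/eqP => vd; have : u \in [set a; c] by rewrite -dE -vd vE !inE eqxx.
  by rewrite !inE (negbTE nua) eq_sym (negbTE ncu).
have nud : u != d.
  apply/eqP => ud; have : v \in [set a; c] by rewrite -dE -ud.
  by rewrite !inE !(eq_sym v) (negbTE av) (negbTE cv).
have nwd : w != d.
  apply/eqP => wd; have : v \in [set a; c] by rewrite -dE -wd.
  by rewrite !inE !(eq_sym v) (negbTE av) (negbTE cv).
have [a' a'u aE] := nbhd_other _ _ _ (reg2 a) ua.
have [c' c'w cE] := nbhd_other _ _ _ (reg2 c) wc.
have da' : d = a'.
  by move: da; rewrite aE !inE eq_sym (negbTE nud) => /eqP.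
have dc' : d = c'.
  by move: dc; rewrite cE !inE eq_sym (negbTE nwd) => /eqP.
subst a' c'.
apply: (@graph_iso_cycle G 5 (fun i : 'I_6 => nth v [:: v; u; a; d; c; w] i)) => //.
  move=> i j /eqP; rewrite nth_uniq //=; first by move/eqP/val_inj.
  rewrite !inE !negb_or nvu eq_sym av nvd (eq_sym v c) cv nvw nua nud.
  by rewrite (eq_sym u c) ncu uw nad ac naw (eq_sym d c) ncd (eq_sym d w) nwd eq_sym nwc.
by case=> [[|[|[|[|[|[|//]]]]]] ?];
  rewrite /= ?vE ?uE ?wE ?aE ?cE ?dE // finset.setUC.
Qed.

(** * Invariance under isomorphism *)

Lemma total_dominating_iso (G H : sgraph) (f : G -> H) (D : {set G}) :
  bijective f -> (forall u v, adj (f u) (f v) = adj u v) ->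
  total_dominating (f @: D) = total_dominating D.
Proof.
case=> g fK gK adjf; apply/forallP/forallP => td v.
  have /existsP[_ /andP[/imsetP[u uD ->] vu]] := td (f v).
  by apply/existsP; exists u; rewrite uD -adjf.
have /existsP[u /andP[uD vu]] := td (g v).
by apply/existsP; exists (f u); rewrite imset_f // -[v]gK adjf.
Qed.

Lemma dt_iso (G H : sgraph) (i : nat) : graph_iso G H -> dt G i = dt H i.
Proof.
case=> f bijf adjf; have injf := bij_inj bijf.
rewrite /dt -(card_imset _ (imset_inj injf)); congr #|pred_of_set _|.
apply/setP=> D; rewrite inE; apply/imsetP/andP.
  case=> D'; rewrite inE => /andP[td /eqP cD] ->.
  by rewrite (total_dominating_iso _ _ _ _ bijf) // card_imset // cD.
case: (bijf) => g fK gK [td cD]; exists (g @: D).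
  rewrite inE -(total_dominating_iso _ _ _ _ bijf) // -imset_comp.
  rewrite (eq_imset (g := id)) ?imset_id ?td //= card_imset //.
  exact: can_inj gK.
by rewrite -imset_comp (eq_imset (g := id)) ?imset_id.
Qed.

Lemma total_domination_poly_iso (A : nzRingType) (G H : sgraph) :
  graph_iso G H -> total_domination_poly A G = total_domination_poly A H.
Proof.
move=> iso; have cGH : #|G| = #|H| by case: iso => f /bij_eq_card.
by rewrite /total_domination_poly cGH; apply: eq_bigr => i _; rewrite (dt_iso _ _ _ iso).
Qed.

(** * The polynomials of the two cycles *)

Lemma nbhd_cycle3 (i : cycle_graph 3) : nbhd i = [set ordS i; ord_pred i].
Proof.
by apply/setP=> j; case: i j => [[|[|[|//]]] ?] [[|[|[|//]]] ?]; rewrite !inE.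
Qed.

Lemma nbhd_cycle6 (i : cycle_graph 6) : nbhd i = [set ordS i; ord_pred i].
Proof.
by apply/setP=> j; case: i j => [[|[|[|[|[|[|//]]]]]] ?] [[|[|[|[|[|[|//]]]]]] ?];
  rewrite !inE.
Qed.

(** The parity classes are the two triangles of the distance-2 graph of the 6-cycle, so a
    [nbhd_free] set meets each class at most once. *)
Lemma odd_or_pair_nbhd_cycle6 (u w : cycle_graph 6) : odd u = odd w ->
  [\/ u = w, w = ordS (ordS u) | u = ordS (ordS w)].
Proof.
case: u w => [[|[|[|[|[|[|//]]]]]] ?] [[|[|[|[|[|[|//]]]]]] ?] //= _;
  by [constructor 1; apply: val_inj | constructor 2; apply: val_inj
     | constructor 3; apply: val_inj].
Qed.

Lemma pair_nbhd_cycle3 (u w : cycle_graph 3) :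
  [\/ u = w, w = ordS (ordS u) | u = ordS (ordS w)].
Proof.
case: u w => [[|[|[|//]]] ?] [[|[|[|//]]] ?];
  by [constructor 1; apply: val_inj | constructor 2; apply: val_inj
     | constructor 3; apply: val_inj].
Qed.

Lemma nbhd_free_cycle (m : nat) (S : {set cycle_graph m}) (u : cycle_graph m) :
  (forall i : cycle_graph m, nbhd i = [set ordS i; ord_pred i]) ->
  nbhd_free S -> u \in S -> ordS (ordS u) \notin S.
Proof.
move=> nbE /forallP/(_ (ordS u)) + uS; apply: contra => uuS.
by apply/fintype.subsetP=> x; rewrite nbE ordSK !inE => /orP[]/eqP->.
Qed.

Lemma nbhd_free_cycle3 (S : {set cycle_graph 3}) : nbhd_free S -> (#|S| < 2)%N.
Proof.
move=> freeS; apply/card_le1_eqP => u w uS wS.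
have := nbhd_free_cycle _ _ u nbhd_cycle3 freeS uS.
have := nbhd_free_cycle _ _ w nbhd_cycle3 freeS wS.
by case: (pair_nbhd_cycle3 u w) => [//|<-|<-]; rewrite ?uS ?wS.
Qed.

Lemma nbhd_free_cycle6 (S : {set cycle_graph 6}) : nbhd_free S -> (#|S| < 3)%N.
Proof.
move=> freeS; rewrite -(@card_in_imset _ _ (fun i : cycle_graph 6 => odd i)).
  by rewrite ltnS -[X in (_ <= X)%N]card_bool max_card.
move=> u w uS wS; have := nbhd_free_cycle _ _ u nbhd_cycle6 freeS uS.
have := nbhd_free_cycle _ _ w nbhd_cycle6 freeS wS.
by move=> nw nu /odd_or_pair_nbhd_cycle6[//|E|E]; move: nw nu; rewrite -E ?uS ?wS.
Qed.

(** The [#|G|] neighbourhoods are distinct pairs, so [dt_order_sub2] removes exactly [#|G|] pairs.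
    For the 3-cycle and the 6-cycle, [dt_eq0] supplies the remaining coefficients. *)
Lemma dt_two_regular (G : sgraph) : (1 < #|G|)%N ->
  (forall v : G, #|nbhd v| = 2%N) -> injective (@nbhd G) ->
  [/\ dt G #|G| = 1, dt G (#|G| - 1) = #|G| & dt G (#|G| - 2) + #|G| = 'C(#|G|, 2)]%N.
Proof.
move=> G1 reg2 injN; have deg (v : G) : (1 < #|nbhd v|)%N by rewrite reg2.
split; [exact: dt_order | by rewrite dt_pred_order //; lia |].
rewrite -(dt_order_sub2 _ G1 deg) card_imset //; congr (_ + _)%N.
by rewrite -cardsT; congr #|pred_of_set _|; apply/setP=> v; rewrite !inE reg2.
Qed.

Lemma cycle3_poly (A : comNzRingType) :
  total_domination_poly A (cycle_graph 3) = 'X^2 * ('X + 3%:R%:P).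
Proof.
have reg2 (v : cycle_graph 3) : #|nbhd v| = 2%N.
  rewrite nbhd_cycle3 cards2; apply/eqP; rewrite eqSS eqb1.
  by case: v => [[|[|[|//]]] ?].
have injN : injective (@nbhd (cycle_graph 3)).
  move=> u w /setP E; apply: val_inj; move: (E (ordS u)) (E (ord_pred u)).
  by rewrite !nbhd_cycle3; case: u w {E} => [[|[|[|//]]] ?] [[|[|[|//]]] ?]; rewrite !inE.
have [] := dt_two_regular _ _ reg2 injN; first by rewrite card_ord.
have := dt_eq0 _ 2 _ nbhd_free_cycle3.
have := dt_eq0 _ 3 _ (fun S freeS => ltnW (nbhd_free_cycle3 S freeS)).
rewrite /total_domination_poly card_ord => /(_ isT) d0 /(_ isT) d1 d3 d2 _.
rewrite !big_ord_recr big_ord0 /= d3 d2 d1 d0.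
by rewrite -!mul_polyC; ring.
Qed.

Lemma cycle6_poly (A : comNzRingType) :
  total_domination_poly A (cycle_graph 6) = 'X^4 * ('X + 3%:R%:P) ^+ 2.
Proof.
have reg2 (v : cycle_graph 6) : #|nbhd v| = 2%N.
  rewrite nbhd_cycle6 cards2; apply/eqP; rewrite eqSS eqb1.
  by case: v => [[|[|[|[|[|[|//]]]]]] ?].
have injN : injective (@nbhd (cycle_graph 6)).
  move=> u w /setP E; apply: val_inj; move: (E (ordS u)) (E (ord_pred u)).
  rewrite !nbhd_cycle6; case: u w {E} => [[|[|[|[|[|[|//]]]]]] ?] [[|[|[|[|[|[|//]]]]]] ?];
    by rewrite !inE.
have [] := dt_two_regular _ _ reg2 injN; first by rewrite card_ord.
have d0 k : (2 < k <= 6)%N -> dt (cycle_graph 6) (6 - k) = 0%N.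
  move=> /andP[k2 k6]; have := dt_eq0 (cycle_graph 6) k; rewrite card_ord.
  by apply=> // S /nbhd_free_cycle6; lia.
move: (d0 3 isT) (d0 4 isT) (d0 5 isT) (d0 6 isT) => {d0}.
rewrite /total_domination_poly card_ord => d3 d2 d1 d0 d6 d5.
rewrite (_ : 'C(6, 2) = 15)%N // => d4'.
have d4 : dt (cycle_graph 6) 4 = 9%N by exact: (addIn (etrans d4' (erefl (9 + 6)%N))).
rewrite !big_ord_recr big_ord0 /= d6 d5 d4 d3 d2 d1 d0.
by rewrite -!mul_polyC; ring.
Qed.

(** * The equivalence, by comparison of coefficients *)

Lemma bin2_mul2 (m : nat) : (2 * 'C(m, 2) = m * m.-1)%N.
Proof. by rewrite -(mul_bin_diag m 1) bin1. Qed.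

Theorem theorem4p7 (R : realType) (G : sgraph) (n : nat)
    (order_G : #|G| = n)
    (conn_G : connected_graph G)
    (min_deg_G : (2 <= min_degree G)%N) :
  root_set (total_domination_poly R[i] G) = [set - 3%:R; 0]%classic
  <-> graph_iso G (cycle_graph 3) \/ graph_iso G (cycle_graph 6).
Proof.
split=> [rootsE | iso]; last first.
  apply/seteqP; split=> z; case: iso => /(total_domination_poly_iso R[i]) ->;
    rewrite /root_set /= ?cycle3_poly ?cycle6_poly
      !(rootE, hornerM, horner_exp, hornerD, hornerX, hornerC)
      !mulf_eq0 !addr_eq0 !orbb.
  - by case/orP=> /eqP ->; [right | left].
  - by case/orP=> /eqP ->; [right | left].
  - by case=> ->; rewrite ?eqxx ?orbT.
  - by case=> ->; rewrite ?eqxx ?orbT.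
have roots z : root (total_domination_poly R[i] G) z <-> z = - 3%:R \/ z = 0.
  by have := congr1 (fun A => A z) rootsE; rewrite /root_set /= => ->.
have deg (v : G) : (1 < #|nbhd v|)%N by apply: leq_trans (min_degree_le G v).
have G0 : (0 < #|G|)%N by case: conn_G.
have dG := dt_order G deg.
(* Here [k] and [l] are the multiplicities of 0 and -3; the degree [#|G|] of the monic polynomial is
   their sum. *)
have [k [l [szE pE]]] : exists k l, #|G| = (k + l)%N /\
    total_domination_poly R[i] G = 'X^k * ('X + 3%:R%:P) ^+ l.
  have sz := size_total_domination_poly R[i] G dG.
  have monp : total_domination_poly R[i] G \is monic.
    by apply/monicP; rewrite lead_coefE sz coef_total_domination_poly // dG.
  have [|k [l pE]] := monic_two_roots _ _ 0 (- 3%:R) monp.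
    by move=> z /roots[]; [right | left].
  exists k, l; move: sz; rewrite pE size_Mmonic ?monic_neq0 ?rpredX ?monicXsubC //.
  by rewrite !size_exp_XsubC polyCN opprK subr0 => sz; split=> //; lia.
(* Characteristic 0 turns the equality of complex coefficients into one of natural numbers. *)
have coefE j : (j <= #|G|)%N -> dt G (#|G| - j) = (3 ^ j * 'C(l, j))%N.
  move=> jG; apply/eqP; rewrite -(Num.Theory.eqr_nat R[i]).
  rewrite -coef_total_domination_poly ?leq_subr // pE szE coef_Xn_XaddC_exp -?szE //.
  by rewrite natrM natrX mulr_natr.
have nE : #|G| = (3 * l)%N.
  by have := coefE 1%N G0; rewrite dt_pred_order // bin1.
have G1 : (1 < #|G|)%N by lia.
have l0 : (0 < l)%N by lia.
have cardN := dt_order_sub2 G G1 deg.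
(* With [#|G| = 3 * l], the count is ['C(3 * l, 2) - 9 * 'C(l, 2) = 3 * l]. Writing [l] as a
   successor removes the predecessors from [bin2_mul2]. *)
have {cardN} cardN : #|[set nbhd v | v in [set v : G | #|nbhd v| == 2]]| = #|G|.
  rewrite coefE // in cardN; have := bin2_mul2 #|G|; have := bin2_mul2 l.
  move: cardN; rewrite nE; case: (l) l0 => // m _; rewrite mulnS !addSn add0n /=.
  move: 'C(m.+1, 2) 'C(_, 2) #|_| => x y z; nia.
(* The vertices of degree 2 have [#|G|] distinct neighbourhoods, so every vertex has degree 2 and
   [nbhd] is injective. *)
have leN := leq_imset_card (@nbhd G) [set v : G | #|nbhd v| == 2%N].
have full : [set v : G | #|nbhd v| == 2%N] = [set: G].
  by apply/eqP; rewrite eqEcard finset.subsetT cardsT -{1}cardN.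
have reg2 (v : G) : #|nbhd v| = 2%N.
  by have := finset.in_setT v; rewrite -full inE => /eqP.
have injN : injective (@nbhd G).
  have /imset_injP injN : #|[set nbhd v | v in [set: G]]| == #|[set: G]|.
    by rewrite -{1}full cardN cardsT.
  by move=> u v; apply: injN.
apply: two_regular_cycle3_or_6 => // S freeS.
(* If [l < #|S|], the coefficient at [#|G| - #|S|] is zero because ['C(l, #|S|) = 0], yet it counts
   [S]. *)
rewrite nE leq_mul2l /= leqNgt; apply/negP => lS.
have SG : (#|S| <= #|G|)%N := max_card _.
have := coefE _ SG; rewrite bin_small // muln0 dt_compl //.
by move/eqP; rewrite cards_eq0 => /eqP/setP/(_ S); rewrite !inE freeS eqxx.
Qed.
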